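(* Let $R'=GR(p^s,p^{sm})$ be a Galois ring ($p$ prime, $s,m\ge1$ integers) and let $r\in R'$. Let $A_r$ and $B_r$ be the control additive gates on $(\mathbb{C}^{p^s})^{\otimes m}\otimes(\mathbb{C}^{p^s})^{\otimes m}$ defined by $$A_r|x\rangle|y\rangle=|x\rangle|y+rx\rangle,\qquad B_r|x\rangle|y\rangle=|x+ry\rangle|y\rangle,\qquad x,y\in R'.$$ Then they have the control/target inversion property $$(\mathcal{F}_{R'}^\dagger\otimes\mathcal{F}_{R'})\,A_r\,(\mathcal{F}_{R'}\otimes\mathcal{F}_{R'}^\dagger)=B_r,$$ where $\mathcal{F}_{R'}$ is the quantum Fourier transform over $R'$.
   Context: Galois ring: $R=\mathbb{Z}_{p^s}$ is the ring of integers modulo $p^s$, and $R'=GR(p^s,p^{sm})=R[X]/(h(X))$ is the Galois ring of characteristic $p^s$ and cardinality $p^{sm}$, where $h\in R[X]$ is a monic basic primitive polynomial of degree $m$ (its reduction mod $p$ is a primitive polynomial over $\mathbb{F}_p$) dividing $X^{p^m-1}-1$ in $R[X]$; $\xi$ denotes the root of $h$ given by the class of $X$, an element of multiplicative order $p^m-1$. Every $x\in R'$ is uniquely $x=\sum_{i=0}^{m-1}x_i\xi^i$ with $x_i\in R$. Trace: the Frobenius automorphism $\phi$ of $R'$ over $R$ is the ring automorphism fixing $R$ with $\phi(\xi)=\xi^p$; it has order $m$, and $\mathrm{Tr}:R'\to R$ is $\mathrm{Tr}(\alpha)=\sum_{i=0}^{m-1}\phi^i(\alpha)$. Basis kets: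 $|x\rangle=|x_0\rangle\otimes\cdots\otimes|x_{m-1}\rangle$, $x\in R'$, is the orthonormal basis of $(\mathbb{C}^{p^s})^{\otimes m}$ obtained from the orthonormal basis $\{|a\rangle\}_{a\in R}$ of $\mathbb{C}^{p^s}$. Quantum Fourier transform: with $\omega_{p^s}=e^{2\pi i/p^s}$ and $\chi_\alpha(u)=\omega_{p^s}^{\mathrm{Tr}(\alpha u)}$, $$\mathcal{F}_{R'}=\frac{1}{\sqrt{p^{sm}}}\sum_{\alpha,u\in R'}\chi_\alpha(u)|\alpha\rangle\langle u|.$$ The symbol $\dagger$ denotes Hermitian conjugation. *)

(* Defs.v *)
From HB Require Import structures.
From mathcomp Require Import all_boot all_order all_algebra all_field.
From mathcomp Require Import mxtens complex.
From mathcomp Require Import reals trigo ring.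

Set Implicit Arguments.
Unset Strict Implicit.
Unset Printing Implicit Defensive.

Import Order.TTheory GRing.Theory Num.Theory.
Local Open Scope ring_scope.

(* {poly %/ h} is the quotient of {poly 'Z_(p ^ s)} by h, and 'qX is the class
   of 'X.  Divisibility is spelled out because 'Z_(p ^ s) is not a domain. *)
Definition galois_poly (p s m : nat) (h : {poly 'Z_(p ^ s)}) : Prop :=
  [/\ h \is monic, size h = m.+1,
      primitive_poly (map_poly (fun a : 'Z_(p ^ s) => (val a)%:R : 'F_p) h) &
      exists g, 'X^(p ^ m - 1) - 1 = g * h].

Definition is_frobenius (p N : nat) (h : {poly 'Z_N})
    (phi : {rmorphism {poly %/ h} -> {poly %/ h}}) : Prop :=
  [/\ bijective phi, forall a, phi (qpolyC h a) = qpolyC h a &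
      phi 'qX = 'qX ^+ p].

(* The sum of the conjugates of x lies in the image of 'Z_N, i.e. it is a
   constant residue (galois_traceE below), and its coefficient of index 0 is
   its value in 'Z_N. *)
Definition galois_trace (m N : nat) (h : {poly 'Z_N})
    (phi : {poly %/ h} -> {poly %/ h}) (x : {poly %/ h}) : 'Z_N :=
  (\sum_(i < m) iter i phi x : {poly %/ h})`_0.

Definition dagger (C : numClosedFieldType) (k l : nat) (M : 'M[C]_(k, l)) :
  'M[C]_(l, k) := map_mx Num.conj M^T.

Section Qudits.
Variable R : realType.

(* v 0 *t v 1 *t ... *t v (k - 1).  The auxiliary fixpoint follows ntensmx of
   mxtens, so that no cast between dimensions is needed. *)
Fixpoint tensor_rec (N k : nat) (v : nat -> 'cV[R[i]]_N) :
    'cV[R[i]]_(N ^ k.+1) :=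
  if k is k'.+1 then v 0%N *t tensor_rec k' (fun i => v i.+1) else v 0%N.

Definition tensor (N k : nat) (v : nat -> 'cV[R[i]]_N) : 'cV[R[i]]_(N ^ k) :=
  if k is k'.+1 return 'cV[R[i]]_(N ^ k) then tensor_rec k' v else 1.

(* For N > 1, 'Z_N has the same elements as 'I_N but is not convertible
   to it, hence the comparison of values. *)
Definition digit_ket (N : nat) (a : 'Z_N) : 'cV[R[i]]_N :=
  \col_(i < N) (val i == val a)%:R.

Definition ket (m N : nat) (h : {poly 'Z_N}) (x : {poly %/ h}) :
    'cV[R[i]]_(N ^ m) :=
  tensor m (fun i => digit_ket (x`_i)).

(* exp (2 i pi / N) *)
Definition omega (N : nat) : R[i] :=
  (cos (2 * pi / N%:R) +i* sin (2 * pi / N%:R))%C.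

Definition qft (m N : nat) (h : {poly 'Z_N})
    (phi : {poly %/ h} -> {poly %/ h}) : 'M[R[i]]_(N ^ m) :=
  (sqrtC (N ^ m)%:R)^-1 *:
    \sum_(a : {poly %/ h}) \sum_(u : {poly %/ h})
      omega N ^+ val (galois_trace m phi (a * u)) *:
        (ket m a *m dagger (ket m u)).

End Qudits.

Section GaloisRingFacts.
Variables (p s m : nat) (h : {poly 'Z_(p ^ s)}).
Hypotheses (p_pr : prime p) (s_gt0 : (0 < s)%N) (m_gt0 : (0 < m)%N).
Hypothesis hG : galois_poly m h.

Local Notation Q := {poly %/ h}.
Local Notation xi := ('qX : Q).
Local Notation ev := (@horner_alg _ Q).
Local Notation n := (p ^ m - 1)%N.

Let ps_gt1 : (1 < p ^ s)%N.
Proof. by rewrite -(expn0 p) ltn_exp2l ?prime_gt1. Qed.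

Let n_gt0 : (0 < n)%N.
Proof. by rewrite subn_gt0 -[X in (X < _)%N](expn0 p) ltn_exp2l ?prime_gt1. Qed.

Let mkh : mk_monic h = h.
Proof. by case: hG => hm hs _ _; rewrite /mk_monic hm hs !ltnS m_gt0. Qed.

Let qpolyC_alg a : qpolyC h a = a%:A.
Proof. by apply: val_inj; rewrite /= -alg_polyC. Qed.

Let ev_xi q : ev xi q = in_qpoly h q.
Proof.
elim/poly_ind: q => [|q c IH]; first by rewrite rmorph0 in_qpoly0.
rewrite !rmorphD !rmorphM /= IH horner_algX horner_algC; congr (_ + _).
rewrite -qpolyC_alg; apply: val_inj => /=.
rewrite Pdiv.CommonRing.rmodp_small //.
by rewrite size_polyC (leq_ltn_trans (leq_b1 _)) // size_mk_monic_gt1.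
Qed.

Let ev_xiK (x : Q) : ev xi (x : {poly _}) = x.
Proof.
rewrite ev_xi; apply: val_inj => /=.
by rewrite Pdiv.CommonRing.rmodp_small ?size_mk_monic.
Qed.

Let ev_xi_h : ev xi h = 0.
Proof.
rewrite ev_xi; apply: val_inj; rewrite /= mkh.
by case: hG => hm _ _ _; rewrite Pdiv.RingMonic.rmodpp.
Qed.

Let xiX : xi ^+ n = 1.
Proof.
case: hG => _ _ _ [g /(congr1 (ev xi))].
rewrite rmorphM /= ev_xi_h mulr0 rmorphB rmorph1 rmorphXn /= horner_algX.
by move/eqP; rewrite subr_eq0 => /eqP.
Qed.

Let addp (a b : Q) : exists w, (a + b) ^+ p = a ^+ p + b ^+ p + p%:R * w.
Proof.
exists (\sum_(1 <= i < p) (a ^+ (p - i) * b ^+ i) *+ ('C(p, i) %/ p)).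
have p0 := prime_gt0 p_pr.
rewrite exprDn -(big_mkord xpredT (fun i => a ^+ (p - i) * b ^+ i *+ 'C(p, i))).
rewrite big_nat_recr //= subnn expr0 mul1r binn mulr1n.
rewrite big_ltn // subn0 bin0 mulr1n expr0 mulr1 addrAC; congr (_ + _).
rewrite mulr_sumr; apply: eq_big_nat => i ip.
rewrite mulr_natl -mulrnA divnK //; exact: prime_dvd_bin.
Qed.

Let algp (c : 'Z_(p ^ s)) : exists w : Q, c%:A ^+ p = c%:A + p%:R * w.
Proof.
have -> : c%:A = (val c)%:R :> Q by rewrite -[in LHS](natr_Zp c) scaler_nat.
move: (val c) => a; rewrite -natrX.
have le : (a <= a ^ p)%N.
  by case: a => [//|a]; rewrite -[X in (X <= _)%N]expn1 leq_pexp2l // prime_gt0.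
have /dvdnP [k hk] : (p %| a ^ p - a)%N.
  by rewrite -eqn_mod_dvd //; apply/eqP/fermat_little.
by exists k%:R; rewrite -natrM [(p * k)%N]mulnC -hk -natrD subnKC.
Qed.

Let ev_xip q : exists w, ev (xi ^+ p) q = ev xi q ^+ p + p%:R * w.
Proof.
elim/poly_ind: q => [|q c [w IH]].
  by exists 0; rewrite !rmorph0 expr0n gtn_eqF ?prime_gt0 // mulr0 addr0.
rewrite !rmorphD !rmorphM /= IH !horner_algX !horner_algC.
have [w1 ->] := addp (ev xi q * xi) c%:A.
have [w2 ->] := algp c.
exists (w * xi ^+ p - w1 - w2).
rewrite exprMn; ring.
Qed.

Let charQ : (p ^ s)%:R = 0 :> Q.
Proof. by rewrite -scaler_nat pchar_Zp // scale0r. Qed.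

Let ev_xip_h : ev (xi ^+ p) h = 0.
Proof.
set y := xi ^+ p; set e := ev y h.
have [w ew] := ev_xip h.
rewrite -/y -/e ev_xi_h expr0n gtn_eqF ?prime_gt0 // add0r in ew.
have e_nil : e ^+ s = 0 by rewrite ew exprMn -natrX charQ mul0r.
case: hG => _ _ _ [g gh].
have yn : y ^+ n = 1 by rewrite -exprM mulnC exprM xiX expr1n.
have ge : ev y g * e = 0.
  rewrite -rmorphM -gh rmorphB rmorph1 rmorphXn /= horner_algX yn; exact: subrr.
have := congr1 (fun q => ev y q^`()) gh.
rewrite derivB derivXn derivC subr0 derivM rmorphMn rmorphD !rmorphM rmorphXn /=.
rewrite horner_algX => dgh.
have e2 : exists v, e = e ^+ 2 * v.
  have [k [kP kk]] : exists k : Q, True /\ k * n%:R = 1.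
    have cop : coprime (p ^ s) n.
      by rewrite coprimeXl // subn1 coprime_sym -(coprime_pexpr _ _ m_gt0) coprimePn ?expn_gt0 ?prime_gt0.
    have nU : (n%:R : 'Z_(p ^ s)) \is a GRing.unit by rewrite unitZpE.
    exists ((n%:R : 'Z_(p ^ s))^-1)%:A; split => //.
    by rewrite -scaler_nat -scalerAl -scalerAr mul1r scalerA mulVr // scale1r.
  exists (ev y g^`() * y * k).
  have E : e * (y ^+ n.-1 *+ n) * y * k = e.
    rewrite -mulr_natr; transitivity (e * (y ^+ n.-1 * y) * (k * n%:R)).
      by ring.
    by rewrite -exprSr prednK // yn kk !mulr1.
  rewrite -[LHS]E dgh.
  transitivity (e ^+ 2 * (ev y g^`() * y * k) + (ev y g * e) * (ev y h^`() * y * k)).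
    by ring.
  by rewrite ge mul0r addr0.
case: e2 => v ev_.
have ek k : e = e ^+ k.+1 * v ^+ k.
  elim: k => [|k IH]; first by rewrite expr0 mulr1.
  rewrite [LHS]ev_ {1}expr2 -mulrA.
  rewrite {2}IH; rewrite [in RHS]exprS [v ^+ k.+1]exprSr; ring.
by rewrite (ek s) exprSr e_nil mul0r mul0r.
Qed.

Let frob (x : Q) : Q := ev (xi ^+ p) (x : {poly _}).

Let frob_zmod : zmod_morphism frob.
Proof. by move=> x y; rewrite /frob -rmorphB. Qed.

Let ev_xip_mod q : ev (xi ^+ p) (in_qpoly h q : {poly _}) = ev (xi ^+ p) q.
Proof.
case: hG => hm _ _ _.
rewrite [in RHS](Pdiv.RingMonic.rdivp_eq hm q) rmorphD rmorphM /= ev_xip_h mulr0.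
by rewrite add0r mkh.
Qed.

Let frob_mul : monoid_morphism frob.
Proof.
split=> [|x y].
  transitivity (frob (in_qpoly h 1)); first by rewrite in_qpoly1.
  by rewrite /frob ev_xip_mod rmorph1.
by rewrite /frob -rmorphM /= -(ev_xip_mod (_ * _)).
Qed.

HB.instance Definition _ := GRing.isZmodMorphism.Build Q Q frob frob_zmod.
HB.instance Definition _ := GRing.isMonoidMorphism.Build Q Q frob frob_mul.

Let frobC a : frob (qpolyC h a) = qpolyC h a.
Proof. by rewrite /frob /= horner_algC qpolyC_alg. Qed.

Let frobX : frob 'qX = 'qX ^+ p.
Proof. by rewrite /frob ev_xip_mod horner_algX. Qed.

Let endo_xi (f : {rmorphism Q -> Q}) k : (forall a, f (qpolyC h a) = qpolyC h a) ->
  f 'qX = 'qX ^+ k -> forall x : Q, f x = ev (xi ^+ k) (x : {poly _}).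
Proof.
move=> fC fX x; rewrite -{1}(ev_xiK x).
elim/poly_ind: (x : {poly _}) => [|q c IH]; first by rewrite !rmorph0.
by rewrite !rmorphD !rmorphM /= IH !horner_algX !horner_algC fX -qpolyC_alg fC.
Qed.

Let iter_frob i : forall x : Q, iter i frob x = ev (xi ^+ (p ^ i)) (x : {poly _}).
Proof.
elim: i => [|i IH] x; first by rewrite /= ev_xiK.
rewrite iterS IH.
elim/poly_ind: (x : {poly _}) => [|q c IHq]; first by rewrite !rmorph0.
rewrite !rmorphD !rmorphM /= IHq !horner_algX !horner_algC -qpolyC_alg frobC.
by rewrite rmorphXn /= frobX -exprM expnS.
Qed.

Lemma frobenius_exists :
  exists2 phi : {rmorphism Q -> Q}, is_frobenius p phi &
    forall psi : {rmorphism Q -> Q}, is_frobenius p psi -> psi =1 phi.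
Proof.
exists frob => [|psi [_ psiC psiX] x]; last by rewrite (endo_xi psiC psiX).
have itm x : iter m frob x = x.
  rewrite iter_frob -[X in _ ^+ X](@subnK 1) ?expn_gt0 ?prime_gt0 //.
  by rewrite exprD xiX mul1r ev_xiK.
split; [exists (iter m.-1 frob) => x | exact: frobC | exact: frobX].
  by rewrite -iterSr prednK.
by rewrite -[LHS]/(iter m.-1.+1 frob x) prednK.
Qed.

Let red (a : 'Z_(p ^ s)) : 'F_p := (val a)%:R.

Let natr_modp k : ((k %% (p ^ s))%N)%:R = k%:R :> 'F_p.
Proof.
have p0 : p%:R = 0 :> 'F_p by exact: pchar_Fp_0.
rewrite [in RHS](divn_eq k (p ^ s)) natrD natrM natrX p0 expr0n.
by rewrite eqn0Ngt s_gt0 mulr0 add0r.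
Qed.

Let red_nat k : red k%:R = k%:R.
Proof. by rewrite /red /= val_Zp_nat // natr_modp. Qed.

Let red_zmod : zmod_morphism red.
Proof.
move=> a b; apply/eqP; rewrite eq_sym subr_eq; apply/eqP.
rewrite -[a in LHS](subrK b) -[X in red (X + _)]natr_Zp -[X in red (_ + X)]natr_Zp.
by rewrite -natrD red_nat natrD.
Qed.

Let red_mul : monoid_morphism red.
Proof.
split=> [|a b]; first by rewrite -[1]/(1%:R) red_nat.
by rewrite -[a in LHS]natr_Zp -[b in LHS]natr_Zp -natrM red_nat natrM.
Qed.

HB.instance Definition _ := GRing.isZmodMorphism.Build 'Z_(p ^ s) 'F_p red red_zmod.
HB.instance Definition _ := GRing.isMonoidMorphism.Build 'Z_(p ^ s) 'F_p red red_mul.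

Let red0 a : red a = 0 -> exists b, a = p%:R * b.
Proof.
move=> a0; have : (p %| val a)%N.
  by rewrite (dvdn_pcharf (pchar_Fp p_pr)); apply/eqP.
case/dvdnP=> k ak; exists k%:R.
by rewrite -[a]natr_Zp ak natrM mulrC.
Qed.

Let inv (x : Q) := exists w, x * w = 1.

Let invM x y : inv x -> inv y -> inv (x * y).
Proof. by move=> [w xw] [z yz]; exists (w * z); rewrite mulrACA xw yz mulr1. Qed.

Let red_poly0 (q : {poly 'Z_(p ^ s)}) : map_poly red q = 0 ->
  exists z, ev xi q = p%:R * z.
Proof.
elim/poly_ind: q => [|q c IH] q0; first by exists 0; rewrite rmorph0 mulr0.
move: (q0); rewrite rmorphD rmorphM /= map_polyX map_polyC /= => /eqP.
rewrite -size_poly_eq0 size_MXaddC; case: ifP => // /andP[/eqP/IH[z qz] /eqP/red0[b cb]] _.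
exists (z * xi + b%:A); rewrite rmorphD rmorphM /= qz horner_algX horner_algC cb.
by rewrite mulrDr mulrA !mulr_natl scalerMnl.
Qed.

Let inv1p z : inv (1 + p%:R * z).
Proof.
exists (\sum_(i < s) (- (p%:R * z)) ^+ i).
have E : (- (p%:R * z)) ^+ s = 0 by rewrite exprNn exprMn -natrX charQ mul0r mulr0.
have := subrXX 1 (- (p%:R * z)) s.
rewrite E expr1n subr0 opprK => E1; rewrite [RHS]E1.
by congr (_ * _); apply: eq_bigr => i _; rewrite expr1n mul1r.
Qed.

Let invX1 k : (0 < k < n)%N -> inv (xi ^+ k - 1).
Proof.
move=> k_n; case: hG => hm hs /primitive_polyP [mi _ hk] _.
have redE : map_poly (fun a : 'Z_(p ^ s) => (val a)%:R : 'F_p) h = map_poly red h by [].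
rewrite redE in mi hk.
have hbs : size (map_poly red h) = m.+1.
  by rewrite size_map_poly_id0 // (eqP hm) rmorph1 oner_eq0.
have hbm : map_poly red h \is monic by exact: monic_map.
move: hk; rewrite card_monic_qpoly ?hbs // card_Fp // -subn1 => /(_ k k_n).
have [irr _] := mi; rewrite -(irreducible_poly_coprime _ irr).
case/Bezout_eq1_coprimepP => -[u v] /= uv.
pose lift (q : {poly 'F_p}) : {poly 'Z_(p ^ s)} := \poly_(i < size q) (val q`_i)%:R.
have liftK q : map_poly red (lift q) = q.
  apply/polyP => i; rewrite coef_map coef_poly.
  case: ltnP => [_|si]; last by rewrite [RHS]nth_default //; exact: (red_nat 0).
  by rewrite [LHS]red_nat; exact: natr_Zp.
have q0 : map_poly red (lift u * h + lift v * ('X^k - 1) - 1) = 0.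
  rewrite rmorphB rmorphD !rmorphM rmorphB rmorph1 /= !liftK map_polyXn.
  by rewrite uv subrr.
have [z] := red_poly0 q0.
rewrite rmorphB rmorphD !rmorphM rmorphB rmorphXn rmorph1 /= ev_xi_h mulr0 add0r.
rewrite horner_algX => e0; have e : ev xi (lift v) * (xi ^+ k - 1) = 1 + p%:R * z.
  by rewrite -e0; ring.
have [w wP] := inv1p z.
by exists (ev xi (lift v) * w); rewrite mulrA [(xi ^+ k - 1) * _]mulrC e.
Qed.

Lemma galois_traceE (phi : {rmorphism Q -> Q}) (x : Q) : is_frobenius p phi ->
  qpolyC h (galois_trace m phi x) = \sum_(i < m) iter i phi x.
Proof.
case=> _ phiC phiX.
have phiE y : phi y = frob y by exact: endo_xi.
have iterE i y : iter i phi y = ev (xi ^+ (p ^ i)) (y : {poly _}).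
  by rewrite -iter_frob; apply: eq_iter.
have itm y : iter m phi y = y.
  rewrite iterE -[X in _ ^+ X](@subnK 1) ?expn_gt0 ?prime_gt0 //.
  by rewrite exprD xiX mul1r ev_xiK.
rewrite /galois_trace; set T : Q := \sum_(i < m) _.
have phiT : phi T = T.
  rewrite /T raddf_sum /= -(prednK m_gt0) big_ord_recr [in RHS]big_ord_recl /=.
  by rewrite -iterS prednK // itm addrC.
have iterT i : iter i phi T = T by elim: i => //= i ->.
pose a : 'rV[Q]_m := \row_i xi ^+ (p ^ i).
pose c : 'rV[Q]_m := \row_i ((T`_i)%:A - T *+ (i == 0%N :> nat)).
have evE y : ev y (T : {poly _}) = \sum_(i < m) (T`_i)%:A * y ^+ i.
  have sT : (size (T : {poly _}) <= m)%N.
    by apply: leq_trans (size_npoly T) _; rewrite mkh; case: hG => _ -> _ _.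
  rewrite -[X in ev _ X](coefK T) poly_def.
  rewrite rmorph_sum /= (big_ord_widen _ (fun i => ev y (T`_i *: 'X^i)) sT).
  rewrite big_mkcond; apply: eq_bigr => i _.
  case: ltnP => [_|si]; last by rewrite nth_default // scale0r mul0r.
  by rewrite -mul_polyC rmorphM rmorphXn /= horner_algC horner_algX.
have cV : c *m Vandermonde m a = 0.
  apply/rowP => i; rewrite !mxE.
  transitivity (ev (xi ^+ (p ^ i)) (T : {poly _}) - T); last first.
    by rewrite -iterE iterT subrr.
  rewrite evE; under eq_bigr do rewrite !mxE mulrBl.
  rewrite sumrB; congr (_ - _).
  rewrite (bigD1 (Ordinal m_gt0)) //= expr0 mulr1 big1 ?addr0 // => j.
  by rewrite -val_eqE /= => /negPf ->; rewrite mul0r.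
have [w wP] : inv (\det (Vandermonde m a)).
  rewrite det_Vandermonde.
  elim/big_ind: _ => [||i _]; [by exists 1; rewrite mulr1 | exact: invM |].
  elim/big_ind: _ => [||j ij]; [by exists 1; rewrite mulr1 | exact: invM |].
  rewrite !mxE -[X in _ ^+ X - _](@subnK (p ^ i)) ?leq_exp2l ?prime_gt1 ?(ltnW ij) //.
  rewrite exprD -[X in _ - X]mul1r -mulrBl; apply: invM; last first.
    exists (xi ^+ (n.-1 * p ^ i)).
    by rewrite -exprD -mulSn prednK // exprM xiX expr1n.
  apply: invX1; rewrite subn_gt0 ltn_exp2l ?prime_gt1 // ij /=.
  have jm : (p ^ j < p ^ m)%N by rewrite ltn_exp2l ?prime_gt1.
  have pi : (0 < p ^ i)%N by rewrite expn_gt0 prime_gt0.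
  apply: leq_ltn_trans (leq_sub2l _ pi) _; apply: ltn_sub2r => //.
  by rewrite -subn_gt0.
have : c *m Vandermonde m a *m \adj (Vandermonde m a) = 0 by rewrite cV mul0mx.
rewrite -mulmxA mul_mx_adj mul_mx_scalar => /rowP/(_ (Ordinal m_gt0)).
rewrite !mxE /= mulr1n => /(congr1 ( *%R w)).
rewrite mulr0 mulrA [w * _]mulrC wP mul1r => /eqP; rewrite subr_eq0 => /eqP E.
by rewrite qpolyC_alg E.
Qed.

End GaloisRingFacts.

Section Kets.
Variable R : realType.

Let dot_tens (k l : nat) (a b : 'cV[R[i]]_k) (c d : 'cV[R[i]]_l) :
  (dagger (a *t c) *m (b *t d)) (0 : 'I_1) (0 : 'I_1) =
  (dagger a *m b) 0 0 * (dagger c *m d) 0 0.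
Proof.
rewrite /dagger trmx_tens map_mxT tensmx_mul mxE.
by rewrite [X in _ X _ * _]ord1 [X in _ _ X * _]ord1 [X in _ * _ X _]ord1 [X in _ * _ _ X]ord1.
Qed.

Let tensor_dot (N k : nat) (v w : nat -> 'cV[R[i]]_N) :
  (dagger (tensor k v) *m tensor k w) 0 0 =
  \prod_(i < k) (dagger (v i) *m w i) 0 0.
Proof.
case: k => [|k] /=.
  by rewrite big_ord0 !mxE big_ord1 !mxE rmorph1 mulr1.
elim: k v w => [|k IH] v w /=; first by rewrite big_ord1.
rewrite big_ord_recl /= -(IH (fun i => v i.+1) (fun i => w i.+1)).
exact: dot_tens.
Qed.

Let digit_dot (N : nat) (a b : 'Z_N) : (1 < N)%N ->
  (dagger (digit_ket R a) *m digit_ket R b) 0 0 = (a == b)%:R.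
Proof.
move=> N1; have aN : (a < N)%N by rewrite -[X in (_ < X)%N]Zp_cast.
rewrite !mxE (bigD1 (Ordinal aN)) //= big1 => [|i]; last first.
  rewrite -val_eqE /= => /negPf ia.
  by rewrite !mxE /= ia rmorph0 mul0r.
by rewrite !mxE /= eqxx rmorph1 mul1r addr0.
Qed.

Lemma ket_orthonormal (p s m : nat) (h : {poly 'Z_(p ^ s)}) (x y : {poly %/ h}) :
  prime p -> (0 < s)%N -> (0 < m)%N -> galois_poly m h ->
  dagger (ket R m x) *m ket R m y = ((x == y)%:R)%:M.
Proof.
move=> p_pr s0 m0 [hm hs _ _].
have N1 : (1 < p ^ s)%N by rewrite -(expn0 p) ltn_exp2l ?prime_gt1.
rewrite [LHS]mx11_scalar tensor_dot; congr (_%:M).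
under eq_bigr do rewrite digit_dot //.
case: eqVneq => [->|xy]; first by rewrite big1 // => i _; rewrite eqxx.
have [i xyi] : exists i : 'I_m, x`_i != y`_i.
  apply/existsP; apply: contraNT xy; rewrite negb_exists => /forallP e.
  have sz (z : {poly %/ h}) : (size (z : {poly _}) <= m)%N.
    apply: leq_trans (size_npoly z) _.
    by rewrite /mk_monic hm hs !ltnS m0 /= hs.
  apply/eqP/val_inj/polyP => i.
  have [im|mi] := ltnP i m; first by have := e (Ordinal im); rewrite negbK => /eqP.
  by rewrite !nth_default // (leq_trans (sz _)).
by rewrite (bigD1 i) //= (negPf xyi) mul0r.
Qed.

Lemma gate_exists (p s m : nat) (h : {poly 'Z_(p ^ s)})
    (f g : {poly %/ h} -> {poly %/ h} -> {poly %/ h}) :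
  prime p -> (0 < s)%N -> (0 < m)%N -> galois_poly m h ->
  exists A : 'M[R[i]]_((p ^ s) ^ m * (p ^ s) ^ m), forall x y : {poly %/ h},
    A *m (ket R m x *t ket R m y) = ket R m (f x y) *t ket R m (g x y).
Proof.
move=> p_pr s0 m0 hG; have ortho := fun x y => @ket_orthonormal p s m h x y p_pr s0 m0 hG.
exists (\sum_(q : {poly %/ h} * {poly %/ h})
          (ket R m (f q.1 q.2) *t ket R m (g q.1 q.2)) *m
          (dagger (ket R m q.1) *t dagger (ket R m q.2))) => x y.
have dot q : (dagger (ket R m q.1) *t dagger (ket R m q.2)) *m
    (ket R m x *t ket R m y) = ((q == (x, y))%:R)%:M.
  rewrite tensmx_mul !ortho; apply/matrixP=> i j; rewrite !mxE.
  rewrite (ord1 (i : 'I_1)) (ord1 (j : 'I_1)) /= !mulr1n -natrM mulnb.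
  by case: q.
rewrite mulmx_suml (bigD1 (x, y)) //= big1 ?addr0 => [|q /negPf qxy].
  by rewrite -mulmxA (dot (x, y)) eqxx mulmx1.
by rewrite -mulmxA dot qxy raddf0 mulmx0.
Qed.

End Kets.

(* Main.v *)
(* F (x) F^dagger sends |x>|y> to the sum of chi(a x - u y) |a>|u> over a and u.
   Applying A_r shifts u to v = u + r a, and
   chi(a x - (v - r a) y) = chi(a (x + r y) - v y), so that
   A_r (F|x> (x) F^dagger|y>) = F|x + r y> (x) F^dagger|y>.  It remains to know
   that F is unitary, i.e. that sum_a chi(a z) = 0 for z <> 0.  This holds as the
   trace form is nondegenerate, because the differences xi - xi^(p^i), 0 < i < m,
   are units: they are nonzero in the residue field, xi being primitive there. *)
From HB Require Import structures.
Require Import Defs.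
From mathcomp Require Import all_boot all_order all_algebra all_field.
From mathcomp Require Import mxtens complex.
From mathcomp Require Import reals trigo ring lra.
Import GRing.Theory.
Local Open Scope ring_scope.

Set Implicit Arguments.
Unset Strict Implicit.
Unset Printing Implicit Defensive.

Import Order.TTheory Num.Theory.

(** * Residues modulo [N] mapped to a ring where [N] vanishes *)

Section ResidueMorphism.
Variables (N : nat) (S : nzRingType).
Hypotheses (N_gt1 : (1 < N)%N) (N0 : N%:R = 0 :> S).

(** The two proofs are arguments so that the morphism instances below attach to the function
    itself. *)
Definition residue of (1 < N)%N & N%:R = 0 :> S := fun a : 'Z_N => (val a)%:R : S.

Local Notation res := (residue N_gt1 N0).

Lemma residue_nat k : res k%:R = k%:R.
Proof.
by rewrite /residue /= val_Zp_nat // [in RHS](divn_eq k N) natrD natrM N0 mulr0 add0r.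
Qed.

Fact residue_zmod : zmod_morphism res.
Proof.
move=> a b; apply/eqP; rewrite eq_sym subr_eq; apply/eqP; rewrite -{1}[a](subrK b).
by move: (a - b) => c; rewrite -[b]natr_Zp -[c]natr_Zp -natrD !residue_nat natrD.
Qed.

Fact residue_monoid : monoid_morphism res.
Proof.
split=> [|a b]; first exact: residue_nat 1.
by rewrite -[a]natr_Zp -[b]natr_Zp -natrM !residue_nat natrM.
Qed.

HB.instance Definition _ := GRing.isZmodMorphism.Build 'Z_N S res residue_zmod.
HB.instance Definition _ := GRing.isMonoidMorphism.Build 'Z_N S res residue_monoid.

End ResidueMorphism.

(** The inverse is the truncated geometric series. *)
Lemma nilpotent_inv1B (A : comNzRingType) (x : A) (k : nat) :
  x ^+ k = 0 -> exists w, (1 - x) * w = 1.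
Proof.
move=> xk; exists (\sum_(i < k) x ^+ i).
have := subrXX 1 x k; rewrite xk expr1n subr0 => E1; rewrite [RHS]E1.
by congr (_ * _); apply: eq_bigr => i _; rewrite expr1n mul1r.
Qed.

(** * Units of the Galois ring and nondegeneracy of the trace form *)

Section GaloisRing.
Variables (p s m : nat) (h : {poly 'Z_(p ^ s)}).
Hypotheses (p_pr : prime p) (s_gt0 : (0 < s)%N) (m_gt0 : (0 < m)%N).
Hypothesis hG : galois_poly m h.

Local Notation Q := {poly %/ h}.

Lemma ps_gt1 : (1 < p ^ s)%N.
Proof. by rewrite -(expn0 p) ltn_exp2l ?prime_gt1. Qed.

Lemma ps_Fp0 : (p ^ s)%:R = 0 :> 'F_p.
Proof. by rewrite natrX pchar_Fp_0 // expr0n gtn_eqF. Qed.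

(** Convertible to the reduction used in [galois_poly], but carrying a ring morphism structure. *)
Definition mod_p := residue ps_gt1 ps_Fp0.

HB.instance Definition _ := GRing.RMorphism.on mod_p.

Lemma mod_p_eq0 (f : {poly 'Z_(p ^ s)}) :
  map_poly mod_p f = 0 -> exists g, f = p%:R *: g.
Proof.
(* Each representative is divisible by [p], so the division is done in the natural numbers. *)
move=> f0; exists (\poly_(i < size f) (val (f`_i)%R %/ p)%:R).
apply/polyP=> i; rewrite coefZ coef_poly.
case: ltnP => [_|fi]; last by rewrite mulr0 nth_default.
have /dvdnP[k ak] : (p %| val (f`_i)%R)%N.
  rewrite (dvdn_pcharf (pchar_Fp p_pr)); apply/eqP.
  by have := congr1 (fun g : {poly _} => g`_i) f0; rewrite coef_map coef0.
by rewrite ak mulnK ?prime_gt0 // -natrM mulnC -ak natr_Zp.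
Qed.

Lemma mod_p_onto (q : {poly 'F_p}) : exists f, map_poly mod_p f = q.
Proof.
exists (\poly_(i < size q) (val q`_i)%:R).
apply/polyP => i; rewrite coef_map coef_poly.
case: ltnP => [_|si]; last by rewrite raddf0 [RHS]nth_default.
by rewrite [LHS]residue_nat; exact: natr_Zp.
Qed.

Lemma mk_monic_id : mk_monic h = h.
Proof. by case: hG => hm hs _ _; rewrite /mk_monic hm hs !ltnS m_gt0. Qed.

Lemma in_qpoly_modulus : in_qpoly h h = 0.
Proof.
apply: val_inj; rewrite /= mk_monic_id.
by case: hG => hm _ _ _; rewrite Pdiv.RingMonic.rmodpp.
Qed.

(* A Bezout relation mod p lifts up to a multiple of p, which is nilpotent. *)
Lemma in_qpoly_unit (f : {poly 'Z_(p ^ s)}) :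
  coprimep (map_poly mod_p h) (map_poly mod_p f) ->
  exists w, in_qpoly h f * w = 1.
Proof.
case/Bezout_eq1_coprimepP => -[u v] /= uv.
have [[U Uu] [V Vv]] := (mod_p_onto u, mod_p_onto v).
have [g gE] : exists g, U * h + V * f - 1 = p%:R *: g.
  apply: mod_p_eq0.
  by rewrite rmorphB rmorphD !rmorphM rmorph1 /= Uu Vv uv subrr.
have E : in_qpoly h V * in_qpoly h f = 1 - - (p%:R *: in_qpoly h g).
  rewrite opprK -linearZ /= -gE rmorphB rmorphD !rmorphM rmorph1 /=.
  by rewrite in_qpoly_modulus mulr0 add0r addrC subrK.
have [|w wP] := @nilpotent_inv1B Q (- (p%:R *: in_qpoly h g)) s.
  by rewrite exprNn exprZn -natrX pchar_Zp ?ps_gt1 // scale0r mulr0.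
by exists (in_qpoly h V * w); rewrite mulrA [X in X * w]mulrC E.
Qed.

(** Mod [p], [h] is irreducible and, being primitive, does not divide ['X^k - 1] for 0 < k < p^m -
    1; take k = p^i - 1 and split off the factor ['X]. *)
Lemma coprimep_conjugates i : (0 < i < m)%N ->
  coprimep (map_poly mod_p h) (map_poly mod_p ('X^(p ^ i) - 'X)).
Proof.
case/andP=> i_gt0 i_m; case: hG => hm hs /primitive_polyP [[irr mon] hn hk] _.
have mod_pE : map_poly (fun a : 'Z_(p ^ s) => (val a)%:R : 'F_p) h =
  map_poly mod_p h by [].
rewrite mod_pE in irr mon hn hk.
have hbs : size (map_poly mod_p h) = m.+1.
  by rewrite size_map_poly_id0 // (eqP hm) rmorph1 oner_eq0.
rewrite card_monic_qpoly ?hbs // card_Fp //= in hn hk.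
have pgt k : (0 < k)%N -> (1 < p ^ k)%N.
  by move=> k0; rewrite -(expn0 p) ltn_exp2l ?prime_gt1.
rewrite rmorphB rmorphXn /= map_polyX.
have -> : 'X^(p ^ i) - 'X = 'X * ('X^((p ^ i).-1) - 1) :> {poly 'F_p}.
  by rewrite mulrBr mulr1 -exprS prednK // ltnW ?pgt.
rewrite coprimepMr (irreducible_poly_coprime ('X^_ - 1)) // hk; last first.
  rewrite -!subn1 subn_gt0 pgt //=.
  by rewrite ltn_sub2r ?pgt // ltn_exp2l ?prime_gt1.
(* If 0 were a root of [h] mod [p], it would be a root of ['X^(p ^ m - 1) - 1], whose value there is
   -1. *)
rewrite andbT coprimepX; apply: contraT; rewrite negbK => /(root_dvdp hn).
rewrite /root !hornerE expr0n gtn_eqF ?sub0r ?oppr_eq0 ?oner_eq0 //.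
by rewrite -ltnS prednK ?pgt // ltnW ?pgt.
Qed.

Variable phi : {rmorphism Q -> Q}.
Hypothesis phiF : is_frobenius p phi.

Lemma iter_frobeniusM i x y : iter i phi (x * y) = iter i phi x * iter i phi y.
Proof. by elim: i => //= i ->; rewrite rmorphM. Qed.

Lemma iter_frobeniusX i k : iter i phi ('qX ^+ k) = ('qX ^+ (p ^ i)) ^+ k.
Proof.
case: phiF => _ _ phiX.
elim: i => [|i IH]; first by rewrite expn0 expr1.
by rewrite /= IH !rmorphXn /= phiX -!exprM expnS mulnA.
Qed.

Lemma galois_traceD x y :
  galois_trace m phi (x + y) = galois_trace m phi x + galois_trace m phi y.
Proof.
rewrite /galois_trace.
have -> : \sum_(i < m) iter i phi (x + y) =
    \sum_(i < m) iter i phi x + \sum_(i < m) iter i phi y.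
  rewrite -big_split; apply: eq_bigr => i _ /=.
  by elim: (val i) => //= k ->; rewrite rmorphD.
by rewrite coefD.
Qed.

(* If z is orthogonal to all powers of xi = 'qX, then sum_i phi^i(z) P(xi^(p^i)) = 0
   for every polynomial P over Q; take P with roots xi^(p^i) for i > 0. *)
Lemma galois_trace_nondegenerate (z : Q) :
  (forall u, galois_trace m phi (z * u) = 0) -> z = 0.
Proof.
move=> z0.
have sum0 k : \sum_(i < m) iter i phi z * ('qX ^+ (p ^ i)) ^+ k = 0.
  (* [galois_trace] is only a coefficient; [galois_traceE] makes the whole sum of conjugates vanish
     with it. *)
  have := galois_traceE p_pr s_gt0 m_gt0 hG (z * 'qX ^+ k) phiF.
  rewrite z0 qpolyC0 => E; rewrite [RHS]E.
  by apply: eq_bigr => i _; rewrite iter_frobeniusM iter_frobeniusX.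
have sumP (P : {poly Q}) : \sum_(i < m) iter i phi z * P.['qX ^+ (p ^ i)] = 0.
  under eq_bigr do rewrite horner_coef mulr_sumr.
  rewrite exchange_big big1 // => k _ /=.
  under eq_bigr do rewrite mulrCA.
  by rewrite -mulr_sumr sum0 mulr0.
pose i0 := Ordinal m_gt0.
have := sumP (\prod_(j < m | j != i0) ('X - ('qX ^+ (p ^ j))%:P)).
rewrite (bigD1 i0) //= [X in _ + X]big1 => [|j j0]; last first.
  by rewrite horner_prod (bigD1 j) //= hornerXsubC subrr mul0r mulr0.
rewrite addr0 horner_prod.
(* Only the term i = 0 survives, so z P(xi) = 0; it remains to invert P(xi), factor by factor. *)
suff [w wP] : exists w,
    (\prod_(j < m | j != i0) ('X - ('qX ^+ (p ^ j))%:P).['qX ^+ (p ^ 0)]) * w = 1 :> Q.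
  by move/(congr1 ( *%R^~ w)); rewrite mul0r -mulrA wP mulr1.
elim/big_ind: _ => [||j j0]; first by exists 1; rewrite mulr1.
  by move=> x y [v xv] [w yw]; exists (v * w); rewrite mulrACA xv yw mulr1.
have jm : (0 < j < m)%N by move: j0; rewrite -val_eqE /= -lt0n ltn_ord => ->.
have [w wP] := in_qpoly_unit (coprimep_conjugates jm).
exists (- w); rewrite hornerXsubC expn0 expr1 mulrN -mulNr opprB.
by rewrite -wP rmorphB rmorphXn.
Qed.

End GaloisRing.

(** * The standard additive character of ['Z_N] *)

Section Phase.
Variables (R : realType) (N : nat).
Hypothesis N_gt1 : (1 < N)%N.

Lemma omegaX k : omega R N ^+ k =
  (cos (2 * pi / N%:R *+ k) +i* sin (2 * pi / N%:R *+ k))%C.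
Proof.
rewrite /omega; move: (2 * pi / N%:R) => t.
elim: k => [|k IH]; first by rewrite !mulr0n cos0 sin0.
rewrite exprSr IH !mulrSr cosD sinD; apply/eqP; rewrite eq_complex /=.
by apply/andP; split; apply/eqP; ring.
Qed.

Lemma omega_order : omega R N ^+ N = 1.
Proof.
rewrite omegaX -[_ *+ N]mulr_natr divfK; last by rewrite pnatr_eq0 -lt0n ltnW.
by rewrite mulr_natl -[pi *+ 2]add0r cosD2pi sinD2pi cos0 sin0.
Qed.

(** With x = pi k / N strictly between 0 and pi, cos 2x = 1 would force sin x = 0. *)
Lemma omega_neq1 k : (0 < k < N)%N -> omega R N ^+ k != 1.
Proof.
case/andP=> k_gt0 kN; rewrite omegaX; apply/eqP => -[c1 _].
have N_gt0 : 0 < N%:R :> R by rewrite ltr0n ltnW.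
pose x : R := pi * (k%:R / N%:R).
have x2 : 2 * pi / N%:R *+ k = x *+ 2.
  by rewrite /x -mulr_natr -[RHS]mulr_natr; ring.
have /sin_gt0_pi sx : 0 < x < pi.
  rewrite /x mulr_gt0 ?pi_gt0 ?divr_gt0 //= ?ltr0n //.
  by rewrite gtr_pMr ?pi_gt0 // ltr_pdivrMr // mul1r ltr_nat.
move: c1; rewrite x2 cos_mulr2n => c1.
have := cos2Dsin2 x; have := exprn_gt0 2 sx; lra.
Qed.

Lemma omega_conj : Num.conj (omega R N) * omega R N = 1.
Proof.
rewrite /omega; move: (2 * pi / N%:R) => t.
apply/eqP; rewrite eq_complex /=; apply/andP; split; apply/eqP; last by ring.
by rewrite -[RHS](cos2Dsin2 t); ring.
Qed.

Definition phase (a : 'Z_N) : R[i] := omega R N ^+ val a.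

Lemma phase0 : phase 0 = 1. Proof. by []. Qed.

Lemma phaseD a b : phase (a + b) = phase a * phase b.
Proof.
by rewrite /phase -exprD /= [X in (_ %% X)%N](Zp_cast N_gt1) expr_mod ?omega_order.
Qed.

Lemma phase_neq1 a : a != 0 -> phase a != 1.
Proof.
move=> a0; apply: omega_neq1; rewrite lt0n; apply/andP; split.
  by rewrite -val_eqE in a0.
by rewrite -[X in (_ < X)%N](Zp_cast N_gt1); exact: ltn_ord.
Qed.

(** Phases have modulus 1, so conjugation is inversion. *)
Lemma phase_conj a : Num.conj (phase a) = phase (- a).
Proof.
have E : Num.conj (phase a) * phase a = 1.
  by rewrite /phase rmorphXn /= -exprMn omega_conj expr1n.
by rewrite -[LHS]mulr1 -phase0 -(subrr a) phaseD mulrA E mul1r.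
Qed.

End Phase.

(** * Algebra of tensor products and adjoints *)

Lemma tensmx11 (A : pzRingType) m n :
  (1%:M : 'M[A]_m) *t (1%:M : 'M[A]_n) = 1%:M.
Proof.
apply/matrixP => i j; case: (mxtens_indexP i) => i1 i2; case: (mxtens_indexP j) => j1 j2.
by rewrite tensmxE !mxE -natrM mulnb (can_eq (@mxtens_indexK _ _)).
Qed.

Section TensorLinear.
Variables (A : comPzRingType) (m n k l : nat).

Lemma tensmxZ (a b : A) (M : 'M_(m, n)) (M' : 'M_(k, l)) :
  (a *: M) *t (b *: M') = (a * b) *: (M *t M').
Proof. by apply/matrixP => i j; rewrite !mxE mulrACA. Qed.

Lemma tensmx_sum (I J : finType) (M : I -> 'M[A]_(m, n)) (M' : J -> 'M[A]_(k, l)) :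
  (\sum_i M i) *t (\sum_j M' j) = \sum_i \sum_j M i *t M' j.
Proof.
apply/matrixP => i j; rewrite mxE !summxE big_distrlr /=.
apply: eq_bigr => x _; rewrite summxE; by apply: eq_bigr => y _; rewrite !mxE.
Qed.

End TensorLinear.

Section Dagger.
Variable C : numClosedFieldType.

Lemma daggerZ m n (a : C) (M : 'M_(m, n)) : dagger (a *: M) = Num.conj a *: dagger M.
Proof. by apply/matrixP => i j; rewrite !mxE rmorphM. Qed.

Lemma dagger_sum m n (I : finType) (M : I -> 'M[C]_(m, n)) :
  dagger (\sum_i M i) = \sum_i dagger (M i).
Proof. by rewrite /dagger !raddf_sum. Qed.

Lemma dagger_mul m n k (M : 'M[C]_(m, n)) (M' : 'M_(n, k)) :
  dagger (M *m M') = dagger M' *m dagger M.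
Proof. by rewrite /dagger trmx_mul map_mxM. Qed.

Lemma daggerK m n (M : 'M[C]_(m, n)) : dagger (dagger M) = M.
Proof. by apply/matrixP => i j; rewrite !mxE conjCK. Qed.

End Dagger.

(** * Unitarity of the Fourier transform and its action on the gate *)

Section Fourier.
Variables (R : realType) (p s m : nat) (h : {poly 'Z_(p ^ s)}).
Variable phi : {rmorphism {poly %/ h} -> {poly %/ h}}.
Hypotheses (p_pr : prime p) (s_gt0 : (0 < s)%N) (m_gt0 : (0 < m)%N).
Hypothesis hG : galois_poly m h.
Hypothesis phiF : is_frobenius p phi.

Local Notation Q := {poly %/ h}.
Local Notation N := (p ^ s)%N.

Let N_gt1 : (1 < N)%N. Proof. exact: ps_gt1. Qed.

Definition chi (x : Q) : R[i] := phase R (galois_trace m phi x).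

Lemma chiD x y : chi (x + y) = chi x * chi y.
Proof. by rewrite /chi galois_traceD // phaseD. Qed.

Lemma galois_trace0 : galois_trace m phi 0 = 0.
Proof. by apply: (addIr (galois_trace m phi 0)); rewrite -galois_traceD !add0r. Qed.

Lemma chi0 : chi 0 = 1.
Proof. by rewrite /chi galois_trace0 phase0. Qed.

Lemma chi_conj x : Num.conj (chi x) = chi (- x).
Proof.
rewrite /chi phase_conj //; congr phase; apply: (addIr (galois_trace m phi x)).
by rewrite addNr -galois_traceD addNr galois_trace0.
Qed.

Lemma card_galois_ring : #|Q| = (N ^ m)%N.
Proof.
case: hG => hm hs _ _.
by rewrite card_monic_qpoly ?hs ?ltnS // card_ord Zp_cast.
Qed.

(** Orthogonality of characters: for nonzero z, nondegeneracy yields b with chi(z b) <> 1, and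
    translating a by b multiplies the sum by chi(z b). *)
Lemma sum_chi (z : Q) : \sum_(a : Q) chi (a * z) = ((z == 0) * N ^ m)%:R.
Proof.
have [->|z0] := eqVneq.
  under eq_bigr do rewrite mulr0 chi0.
  by rewrite sumr_const card_galois_ring mul1n.
have [b b0] : exists b, galois_trace m phi (z * b) != 0.
  apply/existsP; apply: contraNT z0 => /existsPn tr0.
  apply/eqP/(galois_trace_nondegenerate p_pr s_gt0 m_gt0 hG phiF) => u.
  by apply/eqP; have := tr0 u; rewrite negbK.
rewrite mul0n; apply/eqP; have := phase_neq1 R N_gt1 b0; rewrite -/(chi _).
rewrite -subr_eq0 => /mulfI c; apply/eqP/c; rewrite mulr0 mulrBl mul1r.
rewrite [X in _ - X](reindex_inj (addrI b)) /= mulr_sumr -sumrB big1 // => a _.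
by rewrite mulrDl chiD [z * b]mulrC subrr.
Qed.

(** The kets are the columns of a matrix [K], square by [card_galois_ring]; orthonormality gives a
    left inverse, hence also a right inverse. *)
Lemma ket_resolution : \sum_(x : Q) ket R m x *m dagger (ket R m x) = 1%:M.
Proof.
pose e (i : 'I_(N ^ m)) : Q := enum_val (cast_ord (esym card_galois_ring) i).
have e_bij : bijective e.
  exists (cast_ord card_galois_ring \o enum_rank) => x; rewrite /e /=.
    by rewrite enum_valK cast_ordKV.
  by rewrite cast_ordK enum_rankK.
pose K : 'M[R[i]]_(N ^ m) := \matrix_(i, j) ket R m (e j) i 0.
rewrite (reindex e) /=; last exact: onW_bij.
have /mulmx1C <- : dagger K *m K = 1%:M.
  apply/matrixP => i j; rewrite mxE [RHS]mxE -(inj_eq (bij_inj e_bij)).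
  have := ket_orthonormal R (e i) (e j) p_pr s_gt0 m_gt0 hG.
  move/matrixP/(_ 0 0); rewrite mxE [RHS]mxE eqxx mulr1n => <-.
  by apply: eq_bigr => k _; rewrite !mxE.
apply/matrixP => i j; rewrite summxE [RHS]mxE; apply: eq_bigr => k _.
by rewrite !mxE big_ord1 !mxE.
Qed.

Lemma ket_ext k (M M' : 'M_(k, N ^ m)) :
  (forall x : Q, M *m ket R m x = M' *m ket R m x) -> M = M'.
Proof.
move=> MM'; rewrite -[M]mulmx1 -[M']mulmx1 -ket_resolution !mulmx_sumr.
by apply: eq_bigr => x _; rewrite !mulmxA MM'.
Qed.

Lemma ket_tens_ext k (M M' : 'M_(k, N ^ m * N ^ m)) :
  (forall x y : Q, M *m (ket R m x *t ket R m y) = M' *m (ket R m x *t ket R m y)) ->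
  M = M'.
Proof.
move=> MM'; rewrite -[M]mulmx1 -[M']mulmx1.
rewrite -tensmx11 -ket_resolution tensmx_sum !mulmx_sumr; apply: eq_bigr => x _.
rewrite !mulmx_sumr; apply: eq_bigr => y _.
by rewrite -tensmx_mul !mulmxA MM'.
Qed.

Local Notation F := (qft R m phi).

Definition qft_scale : R[i] := (sqrtC (N ^ m)%:R)^-1.

Lemma qft_scale_conj : Num.conj qft_scale = qft_scale.
Proof. by apply: geC0_conj; rewrite invr_ge0 sqrtC_ge0 ler0n. Qed.

Lemma sqr_qft_scale : qft_scale * qft_scale * (N ^ m)%:R = 1.
Proof.
rewrite -expr2 exprVn sqrtCK mulVf // pnatr_eq0 -lt0n !expn_gt0.
by rewrite prime_gt0.
Qed.

Lemma qft_ket (x : Q) :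
  F *m ket R m x = qft_scale *: \sum_(a : Q) chi (a * x) *: ket R m a.
Proof.
rewrite -scalemxAl mulmx_suml; congr (_ *: _); apply: eq_bigr => a _.
rewrite mulmx_suml (bigD1 x) //= big1 ?addr0 => [|u /negPf ux].
  by rewrite -scalemxAl -mulmxA ket_orthonormal // eqxx mulmx1.
by rewrite -scalemxAl -mulmxA ket_orthonormal // ux raddf0 mulmx0 scaler0.
Qed.

Lemma dagger_qft_ket (x : Q) :
  dagger F *m ket R m x = qft_scale *: \sum_(u : Q) chi (- (u * x)) *: ket R m u.
Proof.
rewrite daggerZ qft_scale_conj -scalemxAl dagger_sum mulmx_suml; congr (_ *: _).
(* The adjoint swaps kets and bras, so orthonormality now collapses the outer sum, to a = x. *)
rewrite (bigD1 x) //= [X in _ + X]big1 ?addr0 => [|a /negPf ax].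
  rewrite dagger_sum mulmx_suml; apply: eq_bigr => u _.
  rewrite daggerZ dagger_mul daggerK -scalemxAl -mulmxA ket_orthonormal // eqxx mulmx1.
  by rewrite [X in Num.conj X](_ : _ = chi (x * u)) // chi_conj mulrC.
rewrite dagger_sum mulmx_suml big1 // => u _.
rewrite daggerZ dagger_mul daggerK -scalemxAl -mulmxA ket_orthonormal // ax.
by rewrite raddf0 mulmx0 scaler0.
Qed.

(** Applied to |x>, the coefficient of |u> is, up to scale, the sum over a of chi(a (x - u)), which
    [sum_chi] evaluates. *)
Lemma qft_unitary : dagger F *m F = 1%:M.
Proof.
apply: ket_ext => x; rewrite -mulmxA qft_ket mul1mx -scalemxAr mulmx_sumr.
under eq_bigr do rewrite -scalemxAr dagger_qft_ket scalerA mulrC -scalerA scaler_sumr.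
rewrite -scaler_sumr exchange_big /= scalerA.
under eq_bigr => u _.
  under eq_bigr => a _ do rewrite scalerA -chiD [u * a]mulrC -mulrBr.
  rewrite -scaler_suml sum_chi subr_eq0.
over.
rewrite (bigD1 x) //= big1 ?addr0 => [|u /negPf ux]; last first.
  by rewrite eq_sym ux mul0n scale0r.
by rewrite eqxx mul1n scalerA sqr_qft_scale scale1r.
Qed.

Lemma additive_gate_fourier (r : Q) (A : 'M_(N ^ m * N ^ m)) :
  (forall x y : Q,
     A *m (ket R m x *t ket R m y) = ket R m x *t ket R m (y + r * x)) ->
  forall x y : Q, A *m ((F *m ket R m x) *t (dagger F *m ket R m y)) =
    (F *m ket R m (x + r * y)) *t (dagger F *m ket R m y).
Proof.
move=> AE x y; rewrite !qft_ket !dagger_qft_ket !tensmxZ -scalemxAr; congr (_ *: _).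
rewrite !tensmx_sum mulmx_sumr; apply: eq_bigr => a _.
(* Replacing u by u + r a on the right matches the shift made by [A]; the phases agree since a x - u
   y = a (x + r y) - (u + r a) y. *)
rewrite mulmx_sumr [RHS](reindex_inj (addIr (r * a))) /=; apply: eq_bigr => u _.
rewrite !tensmxZ -scalemxAr AE -!chiD; congr (chi _ *: _); ring.
Qed.

End Fourier.

Theorem corollary3p9 (R : realType) (p s m : nat) (h : {poly 'Z_(p ^ s)})
    (phi : {rmorphism {poly %/ h} -> {poly %/ h}}) (r : {poly %/ h})
    (A B : 'M[R[i]]_((p ^ s) ^ m * (p ^ s) ^ m)) :
  prime p -> (0 < s)%N -> (0 < m)%N ->
  galois_poly m h -> is_frobenius p phi ->
  (forall x y : {poly %/ h},
     A *m (ket R m x *t ket R m y) = ket R m x *t ket R m (y + r * x)) ->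
  (forall x y : {poly %/ h},
     B *m (ket R m x *t ket R m y) = ket R m (x + r * y) *t ket R m y) ->
  let F := qft R m phi in
  (dagger F *t F) *m A *m (F *t dagger F) = B.
Proof.
move=> p_pr s_gt0 m_gt0 hG phiF AE BE F.
apply: (ket_tens_ext p_pr s_gt0 m_gt0 hG) => x y.
rewrite BE -!mulmxA tensmx_mul (additive_gate_fourier phi p_pr s_gt0 m_gt0 hG AE).
have FF := qft_unitary R p_pr s_gt0 m_gt0 hG phiF.
(* The second register needs [F *m dagger F = 1], which follows as [F] is square. *)
by rewrite tensmx_mul !mulmxA FF (mulmx1C FF) !mul1mx.
Qed.
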